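(* Let $L$ be a three-dimensional Lie algebra over the finite field $\mathbb{F}_q$ such that $\dim L'=2$. Let $V=L'$ (a two-dimensional abelian ideal), let $x\in L\setminus V$, and let $T=\mathrm{ad}\,x|_V$, an invertible linear map of $V$. Let $\mathcal{L}$ denote the set of one-dimensional Lie subalgebras (lines) and $\mathcal{P}$ the set of two-dimensional Lie subalgebras (planes) of $L$. Consider the four cases: Case 1: the characteristic polynomial of $T$ is irreducible over $\mathbb{F}_q$; Case 2: $T$ has two different eigenvalues in $\mathbb{F}_q$; Case 3: $T$ has exactly one eigenvalue, lying in $\mathbb{F}_q$, and $T$ is not diagonalizable; Case 4: $T$ is a scalar map. Then: (1) $\mathcal{L}$ has $q^2+q+1$ elements. (2) $|\mathcal{P}|=1$ in Case 1, $|\mathcal{P}|=1+2q$ in Case 2, $|\mathcal{P}|=1+q$ in Case 3, and $|\mathcal{P}|=1+q+q^2$ in Case 4. (3) The following rules hold in all four cases for the comaximal graph $\Gamma(L)$: (a) If $A,B\in\mathcal{P}$ with $A\neq B$, then $A\sim B$. Hence the induced subgraph on $\mathcal{P}$ is a complete graph. (b) If $A\in\mathcal{L}$ and $P\in\mathcal{P}$, then $A\sim P$ if and only if $A\not\subseteq P$. (c) If $A,B\in\mathcal{L}$ are distinct, then $A\not\sim B$ if and only if $A$ and $B$ are contained in a common plane of $\mathcal{P}$. In particular: (i) In Case 1, $\Gamma(L)[\mathcal{L}]$ is the join of an independent set on the $q+1$ lines of $V$ with a complete graph $K_{q^2}$ on the lines outside $V$. (ii) In Case 3, the unique eigenline of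 $T$ in $V$ is an isolated vertex of $\Gamma(L)$, since it is contained in every plane of $\mathcal{P}$. (iii) In Case 4, no two lines are adjacent, since every pair of distinct lines spans a plane in $\mathcal{P}$.
   Context: The comaximal graph $\Gamma(L)$ of a finite-dimensional Lie algebra $L$ is the simple undirected graph whose vertices are the nonzero proper Lie subalgebras of $L$, two distinct vertices $A,B$ being adjacent (written $A\sim B$) if and only if $\langle A,B\rangle=L$, where $\langle A,B\rangle$ denotes the Lie subalgebra generated by $A\cup B$. $\Gamma(L)[S]$ is the subgraph induced on a vertex set $S$. $L'=[L,L]$ is the derived algebra. An eigenline of $T$ is a line in $V$ spanned by an eigenvector of $T$. The join of two graphs on disjoint vertex sets is their union together with all edges between the two vertex sets. *)

(* Defs.v *)
From HB Require Import structures.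
From mathcomp Require Import all_boot all_order all_algebra.

Set Implicit Arguments.
Unset Strict Implicit.
Unset Printing Implicit Defensive.

Import GRing.Theory passmx.
Local Open Scope ring_scope.

(* A finite-dimensional vector space over a finite field has finitely many
   subspaces, so that sets of subalgebras are {set {vspace L}}. *)
Section VspaceFinite.
Import VectorInternalTheory.
HB.instance Definition _ (F : finFieldType) (vT : vectType F) :=
  [Countable of {vspace vT} by <:].
HB.instance Definition _ (F : finFieldType) (vT : vectType F) :=
  [Finite of {vspace vT} by <:].
End VspaceFinite.

HB.mixin Record Vector_isLie (F : fieldType) L of Vector F L := {
  lie : L -> L -> L;
  lieDZl : forall (a : F) x y z, lie (a *: x + y) z = a *: lie x z + lie y z;
  lieDZr : forall (a : F) x y z, lie z (a *: x + y) = a *: lie z x + lie z y;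
  lie_alt : forall x, lie x x = 0;
  lie_jacobi : forall x y z,
    lie x (lie y z) + lie y (lie z x) + lie z (lie x y) = 0
}.

#[short(type="lieAlgType")]
HB.structure Definition LieAlgebra (F : fieldType) :=
  {L of Vector F L & Vector_isLie F L}.

Section LieTheory.
Variables (F : fieldType) (L : lieAlgType F).
Implicit Types (x y : L) (U W X : {vspace L}).

Lemma lie_is_linear x : linear (@lie F L x).
Proof. by move=> a u v; rewrite lieDZr. Qed.

HB.instance Definition _ x :=
  GRing.isLinear.Build F L L _ (@lie F L x) (lie_is_linear x).

Lemma lie0l y : lie 0 y = 0.
Proof. by have := lieDZl (-1) 0 0 y; rewrite scaler0 addr0 scaleN1r addNr. Qed.

Lemma lie_suml (I : Type) (r : seq I) (G : I -> L) y :
  lie (\sum_(i <- r) G i) y = \sum_(i <- r) lie (G i) y.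
Proof.
elim: r => [|i r IHr]; first by rewrite !big_nil lie0l.
by rewrite !big_cons -[G i]scale1r lieDZl !scale1r IHr.
Qed.

Lemma lieZl (a : F) x y : lie (a *: x) y = a *: lie x y.
Proof.
by rewrite -[a *: x]addr0 lieDZl lie0l addr0.
Qed.

(* [U, W]: the span of all brackets (lie_prodvP), given as prodv is for
   associative algebras. *)
Definition lie_prodv U W : {vspace L} :=
  <<[seq lie u w | u <- vbasis U, w <- vbasis W]>>%VS.

Lemma lie_prodvP U W X :
  reflect (forall u w, u \in U -> w \in W -> lie u w \in X)
          (lie_prodv U W <= X)%VS.
Proof.
apply: (iffP span_subvP) => [sX u w uU wW | sX _ /allpairsP[[u w] /= [uU wW ->]]].
  rewrite (coord_vbasis uU) (coord_vbasis wW) lie_suml memv_suml // => i _.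
  rewrite linear_sum memv_suml // => j _.
  by rewrite linearZ /= lieZl !memvZ // sX // allpairs_f ?memt_nth.
by apply: sX; apply: vbasis_mem.
Qed.

Definition lie_derived : {vspace L} := lie_prodv fullv fullv.

Definition lie_subalg U : bool := (lie_prodv U U <= U)%VS.

Definition lie_ideal U : bool := (lie_prodv fullv U <= U)%VS.

Definition lie_abelian U : bool := lie_prodv U U == 0%VS.

(* ad x restricted to V.  The projection vsproj is immaterial when V is stable
   under ad x (adonE), in particular for V = L' (lie_derived_ideal). *)
Definition adon (V : {vspace L}) x : 'End(subvs_of V) :=
  linfun (vsproj V \o lie x \o vsval).

Lemma adonE (V : {vspace L}) x (v : subvs_of V) :
  lie_ideal V -> vsval (adon V x v) = lie x (vsval v).
Proof.
move/lie_prodvP => idV; rewrite lfunE /= vsprojK //.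
by apply: idV; rewrite ?memvf ?subvsP.
Qed.

Lemma lie_derived_ideal : lie_ideal lie_derived.
Proof.
have/lie_prodvP dL := subvv lie_derived.
by apply/lie_prodvP => u w _ _; apply: dL; rewrite memvf.
Qed.

End LieTheory.

Section Endomorphisms.
Variables (F : fieldType) (vT : vectType F).
Implicit Types (T : 'End(vT)).

(* The characteristic polynomial and diagonalizability of T are those of this
   matrix, and do not depend on the choice of the basis. *)
Definition lfun_mx T : 'M[F]_(\dim {:vT}) :=
  mxof (vbasis {:vT}) (vbasis {:vT}) T.

Definition irreducible_lfun T : Prop := irreducible_poly (char_poly (lfun_mx T)).

Definition two_eigenvalues T : Prop :=
  exists a b : F, [/\ a != b, leigenvalue T a & leigenvalue T b].

(* In dimension 2, an eigenvalue in F forces all eigenvalues to lie in F, so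
   uniqueness among the elements of F is uniqueness in any extension of F. *)
Definition one_eigenvalue_nondiag T : Prop :=
  (exists! a : F, leigenvalue T a) /\ ~ diagonalizable (lfun_mx T).

Definition scalar_lfun T : Prop := exists a : F, T = a *: \1%VF.

End Endomorphisms.

(* The eigenlines of T, an endomorphism of the subspace V of vT, are seen as
   subspaces of vT. *)
Definition eigenline (F : fieldType) (vT : vectType F) (V : {vspace vT})
    (T : 'End(subvs_of V)) (E : {vspace vT}) : Prop :=
  exists v : subvs_of V,
    [/\ v != 0, exists a : F, T v = a *: v & E = <[vsval v]>%VS].

Record sgraph (T : finType) := SGraph {
  vset : {set T};
  adj : rel T;
  adj_sym : symmetric adj;
  adj_irr : irreflexive adj;
  adj_vset : forall A B, adj A B -> A \in vset
}.

Section Graphs.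
Variable T : finType.
Implicit Types (G H : sgraph T) (S : {set T}).

(* Leibniz equality would also compare the proofs and the intensional rels. *)
Definition sgraph_eq G H : Prop := vset G = vset H /\ adj G =2 adj H.

Section Induced.
Variables (G : sgraph T) (S : {set T}).
Let adjS : rel T := fun A B => [&& A \in S, B \in S & adj G A B].

Fact induced_sym : symmetric adjS.
Proof. by move=> A B; rewrite /adjS adj_sym andbCA. Qed.

Fact induced_irr : irreflexive adjS.
Proof. by move=> A; rewrite /adjS adj_irr !andbF. Qed.

Fact induced_vset A B : adjS A B -> A \in vset G :&: S.
Proof. by case/and3P=> AS _ /adj_vset AG; rewrite inE AG. Qed.

Definition induced : sgraph T := SGraph induced_sym induced_irr induced_vset.
End Induced.

Section Complete.
Variable S : {set T}.
Let adjS : rel T := fun A B => [&& A \in S, B \in S & A != B].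

Fact complete_sym : symmetric adjS.
Proof. by move=> A B; rewrite /adjS eq_sym andbCA. Qed.

Fact complete_irr : irreflexive adjS.
Proof. by move=> A; rewrite /adjS eqxx !andbF. Qed.

Fact complete_vset A B : adjS A B -> A \in S.
Proof. by case/and3P. Qed.

Definition complete : sgraph T :=
  SGraph complete_sym complete_irr complete_vset.
End Complete.

Section Edgeless.
Variable S : {set T}.
Let adj0 : rel T := fun _ _ => false.

Fact edgeless_sym : symmetric adj0. Proof. by []. Qed.

Fact edgeless_irr : irreflexive adj0. Proof. by []. Qed.

Fact edgeless_vset A B : adj0 A B -> A \in S. Proof. by []. Qed.

Definition edgeless : sgraph T :=
  SGraph edgeless_sym edgeless_irr edgeless_vset.
End Edgeless.

Definition is_join G H1 H2 : Prop :=
  [/\ [disjoint vset H1 & vset H2],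
      vset G = vset H1 :|: vset H2
    & forall A B, adj G A B =
        [|| adj H1 A B, adj H2 A B,
            (A \in vset H1) && (B \in vset H2)
          | (A \in vset H2) && (B \in vset H1)]].

Definition isolated G (A : T) : Prop :=
  A \in vset G /\ forall B, ~~ adj G A B.

End Graphs.

Section Comaximal.
Variables (F : finFieldType) (L : lieAlgType F).
Implicit Types A B U : {vspace L}.

Definition lie_gen A B : {vspace L} :=
  (\bigcap_(U : {vspace L} | [&& lie_subalg U, A <= U & B <= U]) U)%VS.

Lemma lie_genS A B U :
  lie_subalg U -> (A <= U)%VS -> (B <= U)%VS -> (lie_gen A B <= U)%VS.
Proof. by move=> sU AU BU; rewrite /lie_gen (bigcapv_inf U) ?sU ?AU. Qed.

Lemma lie_gen_subalg A B :
  [/\ lie_subalg (lie_gen A B), (A <= lie_gen A B)%VS & (B <= lie_gen A B)%VS].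
Proof.
split; [| by apply/subv_bigcapP => U /and3P[] ..].
apply/lie_prodvP => u w uG wG; rewrite memvE.
apply/subv_bigcapP => U /and3P[sU AU BU]; rewrite -memvE.
by apply: (lie_prodvP _ _ _ sU); apply: (subvP (lie_genS sU AU BU)).
Qed.

Definition comax_vertices : {set {vspace L}} :=
  [set U | [&& lie_subalg U, U != 0%VS & U != fullv]].

Let comax A B : bool :=
  [&& A \in comax_vertices, B \in comax_vertices, A != B
    & lie_gen A B == fullv].

Fact comax_sym : symmetric comax.
Proof.
move=> A B; rewrite /comax andbCA (eq_sym A); do 3!congr (_ && _).
by congr (_ == _); apply: eq_bigl => U; rewrite [(A <= U)%VS && _]andbC.
Qed.

Fact comax_irr : irreflexive comax.
Proof. by move=> A; rewrite /comax eqxx !andbF. Qed.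

Fact comax_vset A B : comax A B -> A \in comax_vertices.
Proof. by case/and3P. Qed.

Definition comax_graph : sgraph {vspace L} :=
  SGraph comax_sym comax_irr comax_vset.

Definition lie_lines : {set {vspace L}} := [set U | lie_subalg U & \dim U == 1%N].

Definition lie_planes : {set {vspace L}} := [set U | lie_subalg U & \dim U == 2%N].

End Comaximal.

Arguments lie_derived {F} L.
Arguments comax_vertices {F} L.
Arguments comax_graph {F} L.
Arguments lie_lines {F} L.
Arguments lie_planes {F} L.

(* Main.v *)
(* V = L' is abelian by the Jacobi identity and T is injective, since otherwise
   dim L' <= 1.  A plane subalgebra W other than V meets V in a line which is
   an ideal of L, i.e. an eigenline of T, and conversely every plane through an
   ideal line is a subalgebra.  As q of the q + 1 planes through a line of V
   differ from V, |planes| = 1 + q * #(eigenlines), and T has 0, 2, 1, q + 1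
   eigenlines in the four cases.  The adjacency rules only use dim L = 3. *)

Require Import Defs.
From mathcomp Require Import all_boot all_order all_algebra ring.

Import GRing.Theory passmx.
Local Open Scope ring_scope.

(** * Lines and planes in a vector space *)

Section VectorSpaces.
Set Implicit Arguments.
Unset Strict Implicit.
Variables (K : fieldType) (vT : vectType K).
Implicit Types (u v : vT) (E U W : {vspace vT}).

Lemma vspace1P E : \dim E = 1%N -> exists2 e, e != 0 & E = <[e]>%VS.
Proof.
move=> dE; have E0 : E != 0%VS by rewrite -dimv_eq0 dE.
have e0 : vpick E != 0 by rewrite vpick0.
exists (vpick E) => //; apply/eqP.
by rewrite eq_sym eqEdim -memvE memv_pick dE dim_vline e0.
Qed.

Lemma vline_eq u v : u != 0 -> u \in <[v]>%VS -> <[u]>%VS = <[v]>%VS.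
Proof.
move=> u0 uv; apply/eqP; rewrite eqEdim -memvE uv !dim_vline u0.
by case: (v != 0).
Qed.

Lemma dim_addv_vline v U : v \notin U -> \dim (U + <[v]>) = (\dim U).+1.
Proof.
move=> vU; have v0 : v != 0 by apply: contraNneq vU => ->; rewrite mem0v.
rewrite dimv_disjoint_sum ?dim_vline ?v0 ?addn1 //.
apply/eqP; rewrite -subv0; apply/subvP => y; rewrite memv_cap memv0.
case/andP=> yU /vlineP[k yk]; rewrite yk scaler_eq0.
apply: contraNT vU => /norP[k0 _].
by rewrite -[v]scale1r -(mulVf k0) -scalerA -yk memvZ.
Qed.

Lemma dim_plane_add_line E U : \dim E = 1%N -> \dim U = 2%N ->
  ~~ (E <= U)%VS -> \dim (U + E) = 3%N.
Proof.
by move=> /vspace1P[e _ ->] dU; rewrite -memvE => /dim_addv_vline; rewrite dU.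
Qed.

Lemma dim_add_lines E W :
  \dim E = 1%N -> \dim W = 1%N -> E != W -> \dim (E + W) = 2%N.
Proof.
move=> dE /[dup] dW /vspace1P[w w0 defW] EW; rewrite defW dim_addv_vline ?dE //.
by apply: contra EW => wE; rewrite eq_sym eqEdim dE dW defW -memvE wE.
Qed.

Lemma exists_notin_vline U v :
  (1 < \dim U)%N -> exists2 w, w \in U & w \notin <[v]>%VS.
Proof.
move=> dU; have /subvPn[w] : ~~ (U <= <[v]>)%VS.
  by apply: contraL dU => /dimvS; rewrite dim_vline -leqNgt;
    case: (v != 0) => // /leq_trans->.
by exists w.
Qed.

Lemma vspace2_coord U u w v : \dim U = 2%N -> u != 0 -> u \in U -> w \in U ->
  w \notin <[u]>%VS -> v \in U -> exists a b, v = a *: u + b *: w.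
Proof.
move=> dU u0 uU wU wu vU; have defU : U = (<[u]> + <[w]>)%VS.
  apply/eqP; rewrite eq_sym eqEdim subv_add -!memvE uU wU dU.
  by rewrite dim_addv_vline // dim_vline u0.
move: vU; rewrite defU => /memv_addP[_ /vlineP[a ->] [_ /vlineP[b ->] ->]].
by exists a, b.
Qed.

Lemma lin_indep2 u w a b : u != 0 -> w \notin <[u]>%VS ->
  a *: u + b *: w = 0 -> a = 0 /\ b = 0.
Proof.
move=> u0 wu abE; have b0 : b = 0.
  apply/eqP; apply: contraNT wu => b0; apply/vlineP; exists (- (b^-1 * a)).
  apply: (scalerI b0); rewrite scalerA mulrN mulrA divff // mul1r scaleNr.
  by apply/eqP; rewrite -addr_eq0 addrC abE.
split=> //; move/eqP: abE; rewrite b0 scale0r addr0 scaler_eq0 (negPf u0) orbF.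
by move/eqP.
Qed.

End VectorSpaces.

(** * Numbers of lines and planes over a finite field *)

Section Counting.
Set Implicit Arguments.
Unset Strict Implicit.
Variables (F : finFieldType) (vT : vectType F).
Implicit Types (u v : vT) (E U W : {vspace vT}).

Definition lines_of U : {set {vspace vT}} :=
  [set E | (\dim E == 1%N) && (E <= U)%VS].

Definition planes_over E : {set {vspace vT}} :=
  [set W | (\dim W == 2%N) && (E <= W)%VS].

(* The lines of U + <u> outside U are the <u + v>, with a unique v in U. *)
Lemma card_lines_off U u : u \notin U ->
  #|lines_of (U + <[u]>) :\: lines_of U| = (#|F| ^ \dim U)%N.
Proof.
move=> uU; pose s (c : 'rV[F]_(\dim U)) := \sum_i c 0 i *: (vbasis U)`_i.
have sU c : s c \in U by apply: memv_suml => i _;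
  rewrite memvZ ?vbasis_mem ?mem_nth ?size_tuple.
have u_s c : u + s c \notin U by rewrite rpredDr.
have us0 c : u + s c != 0 by apply: contraNneq (u_s c) => ->; rewrite mem0v.
rewrite -[in RHS](mul1n (\dim U)) -card_mx -cardsT.
rewrite -(@card_in_imset _ _ (fun c => <[u + s c]>%VS) setT); last first.
  move=> c d _ _ eq_cd.
  have /vlineP[k cE]: u + s c \in <[u + s d]>%VS by rewrite -eq_cd memv_line.
  (* From u + s c = k (u + s d), the vector (1 - k) u equals k (s d) - s c, which lies in U; as u
     does not, k must be 1. *)
  have k1 : k = 1.
    apply/eqP; rewrite eq_sym -subr_eq0; apply: contraNT uU => k1.
    have: (1 - k) *: u \in U.
      rewrite scalerBl scale1r; have -> : u - k *: u = k *: s d - s c.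
        rewrite -[LHS](addrK (s c)) [u - _ + _]addrAC cE scalerDr.
        by rewrite [_ + _ - k *: u]addrAC subrr add0r.
      by rewrite memvB // memvZ.
    by move=> /(memvZ (1 - k)^-1); rewrite scalerA mulVf // scale1r.
  move: cE; rewrite k1 scale1r => /addrI eq_s; apply/rowP => i.
  have fr := basis_free (vbasisP U).
  by rewrite -[LHS](coord_sum_free _ _ fr) -/(s c) eq_s coord_sum_free.
apply: eq_card => E; rewrite !inE; apply/andP/imsetP =>
  [[EU /andP[/eqP dE]]|[c _ ->]]; last first.
  rewrite dim_vline us0 -!memvE u_s; split=> //.
  by rewrite addrC memv_add // memv_line.
have [e e0 defE] := vspace1P dE; rewrite defE -memvE =>
  /memv_addP[v vU [_ /vlineP[a ->] eE]].
have a0 : a != 0.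
  apply: contraNneq EU => a0; rewrite dE defE -memvE eE a0 scale0r addr0.
  exact: vU.
exists (\row_i coord (vbasis U) i (a^-1 *: v)) => //.
have -> : s (\row_i coord (vbasis U) i (a^-1 *: v)) = a^-1 *: v.
  rewrite [RHS](coord_vbasis (memvZ _ vU)).
  by apply: eq_bigr => i _; rewrite mxE.
apply: vline_eq => //; apply/vlineP; exists a.
by rewrite scalerDr scalerA divff // scale1r addrC.
Qed.

(** Induction on the dimension: remove a line <u> from U and keep a complement W. The induction
    hypothesis counts the lines inside W, and [card_lines_off] counts the other lines of U as q to
    the power dim W, which is the new last term of the sum. *)
Lemma card_lines U : #|lines_of U| = (\sum_(i < \dim U) #|F| ^ i)%N.
Proof.
move: {2}(\dim U) (erefl (\dim U)) => n.
elim: n U => [|n IHn] U dU.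
  rewrite dU big_ord0; apply/eqP; rewrite cards_eq0; apply/eqP/setP => E.
  rewrite !inE; apply/negP => /andP[/eqP dE /dimvS].
  by rewrite dE dU.
have U0 : vpick U != 0 by rewrite vpick0 -dimv_eq0 dU.
pose u := vpick U; pose W := (U :\: <[u]>)%VS.
have dW : \dim W = n.
  have := dimv_cap_compl U <[u]>%VS.
  rewrite (capv_idPr _) -?memvE ?memv_pick // dim_vline U0 dU add1n.
  by case.
have uW : u \notin W.
  apply: contra U0 => uW; rewrite -memv0 -(capv_diff U <[u]>).
  by rewrite memv_cap uW memv_line.
have defU : U = (W + <[u]>)%VS.
  apply/eqP; rewrite eq_sym eqEdim subv_add diffvSl -memvE memv_pick.
  by rewrite dim_addv_vline // dW dU ltnSn.
rewrite dU big_ord_recr /= -dW -IHn // -(card_lines_off uW) -defU.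
rewrite -(cardsID (lines_of W) (lines_of U)); congr (#|pred_of_set _| + _)%N.
apply/setP => E; rewrite !inE andbACA andbb.
by case: (boolP (E <= W)%VS) => [/subv_trans -> //|_]; rewrite ?diffvSl ?andbF.
Qed.

(* W |-> W :&: C is a bijection to the lines of a complement C of E. *)
Lemma card_planes_over E :
  \dim {:vT} = 3%N -> \dim E = 1%N -> #|planes_over E| = (#|F| + 1)%N.
Proof.
move=> dT dE; pose C := (E^C)%VS.
have dC : \dim C = 2%N by rewrite dimv_compl dT dE.
have -> : (#|F| + 1)%N = #|lines_of C|.
  by rewrite card_lines dC big_ord_recr big_ord1 /= expn1 addnC.
rewrite -(card_in_imset (f := addv E) (D := lines_of C)).
  apply: eq_card => W; rewrite !inE; apply/andP/imsetP => [[/eqP dW EW]|[M]].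
    have defW : (E + C :&: W = W)%VS.
      by rewrite vspace_modl // addv_complf capfv.
    exists (C :&: W)%VS => //; rewrite inE capvSl andbT.
    have := dimv_sum_cap E (C :&: W); rewrite defW.
    rewrite dW dE capvA capv_compl cap0v dimv0 addn0 add1n.
    by case=> <-.
  rewrite inE => /andP[/eqP dM MC] ->; rewrite addvSl; split=> //.
  rewrite dimv_disjoint_sum ?dE ?dM //; apply/eqP; rewrite -subv0.
  by rewrite -(capv_compl E) capvS.
have capK M : (M <= C)%VS -> ((E + M) :&: C = M)%VS.
  by move=> MC; rewrite addvC -vspace_modl // capv_compl addv0.
move=> M N; rewrite !inE => /andP[_ /capK {2}<-] /andP[_ /capK {2}<-] eqMN.
by rewrite eqMN.
Qed.

End Counting.

(** * Brackets and subalgebras in an arbitrary Lie algebra *)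

Section LieAlgebras.
Set Implicit Arguments.
Unset Strict Implicit.
Variables (K : fieldType) (L : lieAlgType K).
Implicit Types (u v y : L) (E U W P : {vspace L}).

Lemma lieDl u v y : lie (u + v) y = lie u y + lie v y.
Proof. by rewrite -[u]scale1r lieDZl !scale1r. Qed.

Lemma lieC u v : lie u v = - lie v u.
Proof.
have := lie_alt (u + v); rewrite lieDl !linearD /= !lie_alt add0r addr0.
by move/eqP; rewrite addr_eq0 => /eqP.
Qed.

(** An alternating bilinear map scales by the determinant of the coefficients, so all brackets
    within a plane are multiples of a single one. *)
Lemma lie_comb2 u w a b c d :
  lie (a *: u + b *: w) (c *: u + d *: w) = (a * d - b * c) *: lie u w.
Proof.
rewrite lieDl !lieZl !linearD !linearZ /= !lie_alt !scaler0 add0r addr0.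
by rewrite [lie w u]lieC !scalerN !scalerA scalerBl (mulrC d) (mulrC c).
Qed.

Lemma lie_subalg_line E : \dim E = 1%N -> lie_subalg E.
Proof.
move=> /vspace1P[e _ ->]; apply/lie_prodvP => _ _ /vlineP[a ->] /vlineP[b ->].
by rewrite lieZl linearZ /= lie_alt !scaler0 mem0v.
Qed.

(** All brackets already fall into E: each term has an argument in the ideal E, except the one from
    [y, y], which vanishes. *)
Lemma lie_subalg_add_ideal E y : lie_ideal E -> lie_subalg (E + <[y]>).
Proof.
move=> /lie_prodvP idE; apply/lie_prodvP.
move=> u w /memv_addP[e eE [_ /vlineP[a ->] ->]].
move=> /memv_addP[f fE [_ /vlineP[b ->] ->]].
apply: (subvP (addvSl _ _)); rewrite lieDl !linearD /= rpredD //.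
  by rewrite rpredD 1?[lie e (_ *: _)]lieC ?rpredN // idE ?memvf.
by rewrite (lieZl a y (b *: y)) linearZ /= lie_alt !scaler0 addr0 idE ?memvf.
Qed.

End LieAlgebras.

(** * Structure of L when dim L = 3 and dim L' = 2 *)

Section ThreeDim.
Set Implicit Arguments.
Unset Strict Implicit.
Variables (K : fieldType) (L : lieAlgType K) (x : L).
Hypotheses (dimL : \dim {:L} = 3%N) (dimL' : \dim (lie_derived L) = 2%N).
Hypothesis (xV : x \notin lie_derived L).
Local Notation V := (lie_derived L).
Local Notation T := (adon V x).
Implicit Types (u v y : L) (E W P : {vspace L}).

Lemma lie_derived_mem u v : lie u v \in V.
Proof.
by have /lie_prodvP := subvv V; apply; rewrite memvf.
Qed.

Lemma decomp_derived y : exists2 v, v \in V & exists k, y = v + k *: x.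
Proof.
have /memv_addP[v vV [_ /vlineP[k ->] ->]] : y \in (V + <[x]>)%VS.
  suff -> : (V + <[x]>)%VS = fullv by rewrite memvf.
  by apply/eqP; rewrite eqEdim subvf dim_addv_vline // dimL dimL'.
by exists v => //; exists k.
Qed.

(** Since L = V + <x> and [x, x] = 0, brackets with x and brackets inside V generate L'. The lemma
    serves to contradict dim L' = 2 by trapping L' in a line W. *)
Lemma lie_derived_sub W : {in V, forall v, lie x v \in W} ->
  {in V &, forall u v, lie u v \in W} -> (V <= W)%VS.
Proof.
move=> xW uW; apply/lie_prodvP => y z _ _.
have [v vV [k ->]] := decomp_derived y; have [w wV [l ->]] := decomp_derived z.
rewrite lieDl !linearD /= !lieZl !linearZ /= lie_alt !scaler0 addr0.
rewrite [lie v x]lieC; apply: rpredD; last by rewrite rpredZ ?xW.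
by apply: rpredD; rewrite ?uW // rpredZ // rpredN xW.
Qed.

(* Write c = [u, w] = al u + be w for a basis (u, w) of V.  The Jacobi identity
   for x, u, w makes [x, u] and [x, w] multiples of c if c != 0, so that
   dim L' <= 1. *)
Lemma lie_derived_abelian : {in V &, forall u v, lie u v = 0}.
Proof.
have [u [w [u0 uV wV wu]]] : exists u w,
    [/\ u != 0, u \in V, w \in V & w \notin <[u]>%VS].
  have [w wV wu] := exists_notin_vline (vpick V) (eq_leq (esym dimL')).
  by exists (vpick V), w; rewrite vpick0 -dimv_eq0 dimL' memv_pick.
have VE v : v \in V -> exists a b, v = a *: u + b *: w by apply: vspace2_coord.
suff c0 : lie u w = 0.
  by move=> _ _ /VE[a [b ->]] /VE[c [d ->]]; rewrite lie_comb2 c0 scaler0.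
apply/eqP; apply/negPn/negP => c0.
have [al [be cE]] := VE _ (lie_derived_mem u w).
have [p [r xu]] := VE _ (lie_derived_mem x u).
have [s [t xw]] := VE _ (lie_derived_mem x w).
(* These are the two coordinates of the Jacobi identity in the basis (u, w). They say that (s, t)
   and (p, r), the coordinates of [x, w] and [x, u], are parallel to (al, be). *)
have [sE rE] : be * s - al * t = 0 /\ al * r - be * p = 0.
  apply: (lin_indep2 u0 wu); rewrite -[RHS](lie_jacobi x u w).
  rewrite [lie w x]lieC xw xu cE linearN !linearD !linearZ /= xw xu !lie_alt.
  rewrite [lie w u]lieC cE.
  have combD a b c d : a *: u + b *: w + (c *: u + d *: w) =
      (a + c) *: u + (b + d) *: w.
    by rewrite addrACA -!scalerDl.
  have combZ k a b : k *: (a *: u + b *: w) = (k * a) *: u + (k * b) *: w.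
    by rewrite scalerDr !scalerA.
  rewrite !oppr0 !scaler0 add0r addr0 !scalerN -!scaleNr !combZ !combD.
  by congr (_ *: _ + _ *: _); ring.
move: sE rE => /eqP; rewrite subr_eq0 => /eqP sE /eqP;
  rewrite subr_eq0 => /eqP rE.
suff [xuc xwc] : lie x u \in <[lie u w]>%VS /\ lie x w \in <[lie u w]>%VS.
  suff /dimvS : (V <= <[lie u w]>)%VS by rewrite dimL' dim_vline;
    case: (_ != 0).
  apply: lie_derived_sub.
    by move=> _ /VE[a [b ->]]; rewrite linearD !linearZ rpredD ?rpredZ.
  by move=> _ _ /VE[a [b ->]] /VE[c [d ->]]; rewrite lie_comb2 rpredZ
    ?memv_line.
(* The proportionality factors are obtained by dividing by a coordinate of c known to be nonzero: be
   if al = 0, and al otherwise. *)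
have [al0|al0] := eqVneq al 0.
  have be0 : be != 0.
    by apply: contraNneq c0 => be0; rewrite cE al0 be0 !scale0r addr0.
  split; apply/vlineP; [exists (r / be)|exists (t / be)].
    rewrite xu cE scalerDr !scalerA divfK //; congr (_ *: _ + _).
    by apply: (mulfI be0); rewrite -rE; field.
  rewrite xw cE scalerDr !scalerA divfK //; congr (_ *: _ + _).
  by apply: (mulfI be0); rewrite sE; field.
split; apply/vlineP; [exists (p / al)|exists (s / al)].
  rewrite xu cE scalerDr !scalerA divfK //; congr (_ + _ *: _).
  by apply: (mulfI al0); rewrite rE; field.
rewrite xw cE scalerDr !scalerA divfK //; congr (_ + _ *: _).
by apply: (mulfI al0); rewrite -sE; field.
Qed.

(** Complete a nonzero v with [x, v] = 0 to a basis (v, w) of V. As V is abelian, [x, w] alone would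
    span L', contradicting dim L' = 2. *)
Lemma lie_x_eq0 v : v \in V -> lie x v = 0 -> v = 0.
Proof.
move=> vV xv; apply/eqP; apply/negPn/negP => v0.
have [w wV wv] := exists_notin_vline v (eq_leq (esym dimL')).
suff /dimvS : (V <= <[lie x w]>)%VS by rewrite dimL' dim_vline; case: (_ != 0).
apply: lie_derived_sub => [u|u1 u2] uV; last first.
  by move=> u2V; rewrite lie_derived_abelian ?mem0v.
have [a [b ->]] := vspace2_coord dimL' v0 vV wV wv uV.
by rewrite linearD !linearZ /= xv scaler0 add0r rpredZ ?memv_line.
Qed.

Lemma adon_derivedE (v : subvs_of V) : vsval (T v) = lie x (vsval v).
Proof. exact: adonE (lie_derived_ideal L). Qed.

Lemma adon_derived_bij : bijective T.
Proof.
suff kT : lker T == 0%VS.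
  by exists (T^-1)%VF; [apply: lker0_lfunK|apply: lker0_lfunVK].
rewrite -subv0; apply/subvP => v; rewrite memv_ker memv0 => /eqP Tv.
apply/eqP/subvs_inj; rewrite linear0; apply: lie_x_eq0 (subvsP v) _.
by rewrite -adon_derivedE Tv linear0.
Qed.

(* k is the coordinate of y along x modulo V. *)
Lemma lie_derived_r y v : v \in V ->
  exists2 k, lie y v = k *: lie x v & k = 0 -> y \in V.
Proof.
move=> vV; have [w wV [k ->]] := decomp_derived y; exists k.
  by rewrite lieDl lieZl lie_derived_abelian // add0r.
by move=> ->; rewrite scale0r addr0.
Qed.

(** Every ad y acts on V as a multiple of ad x, so stability under x alone makes a line of V an
    ideal of L. *)
Lemma lie_ideal_vlineP v : v \in V ->
  reflect (exists a, lie x v = a *: v) (lie_ideal <[v]>).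
Proof.
move=> vV; apply: (iffP (lie_prodvP _ _ _)) => [idv|[a xv] y _ _ /vlineP[b ->]].
  by apply/vlineP; apply: idv; rewrite ?memvf ?memv_line.
by have [k yv _] := lie_derived_r y vV; rewrite linearZ /= yv xv !rpredZ
  ?memv_line.
Qed.

(** Some y in W lies outside V and acts on V as a nonzero multiple of ad x. Stability of the
    intersection under y therefore gives stability under x, hence under all of L. *)
Lemma lie_subalg_meet W : lie_subalg W -> ~~ (W <= V)%VS ->
  lie_ideal (W :&: V).
Proof.
move=> /lie_prodvP sW /subvPn[y yW yV]; apply/lie_prodvP => z v _.
rewrite memv_cap => /andP[vW vV]; rewrite memv_cap lie_derived_mem andbT.
have [k yv k0] := lie_derived_r y vV; have [l -> _] := lie_derived_r z vV.
have {}k0 : k != 0 by apply: contraNneq yV => /k0.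
apply: rpredZ; rewrite -[lie x v]scale1r -(mulVf k0) -scalerA -yv.
by rewrite rpredZ ?sW.
Qed.

End ThreeDim.

(** * Eigenvalues of an endomorphism and its matrix *)

Section Eigenvalues.
Set Implicit Arguments.
Unset Strict Implicit.
Variables (K : fieldType) (vT : vectType K) (T : 'End(vT)).

Lemma leigenvalueP a :
  reflect (exists2 v, v != 0 & T v = a *: v) (leigenvalue T a).
Proof.
have memE v : (v \in leigenspace T a) = (T v == a *: v).
  by rewrite memv_ker add_lfunE opp_lfunE scale_lfunE id_lfunE subr_eq0.
apply: (iffP idP) => [|[v v0 Tv]].
  rewrite /leigenvalue -vpick0; set v := vpick _ => v0.
  by exists v => //; apply/eqP; rewrite -memE memv_pick.
apply: contraNneq v0 => T0; rewrite -memv0 -T0 memE; exact/eqP.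
Qed.

Lemma leigenvalue_root a :
  leigenvalue T a = root (char_poly (lfun_mx T)) a.
Proof.
rewrite -eigenvalue_root_char /leigenvalue.
by rewrite (leigenspaceE (vbasisP _)) vsof_eq0 ?vbasisP.
Qed.

(** An eigenvalue would give a linear factor of the characteristic polynomial, whose degree is 2. *)
Lemma irreducible_lfun_no_eigenvalue a :
  \dim {:vT} = 2%N -> irreducible_lfun T -> ~~ leigenvalue T a.
Proof.
move=> d2 [_ irr]; rewrite leigenvalue_root -dvdp_XsubCl.
apply/negP => /irr; rewrite size_XsubC => /(_ isT) /eqp_size.
by rewrite size_XsubC size_char_poly d2.
Qed.

Lemma scalar_lfun_diagonalizable : scalar_lfun T -> diagonalizable (lfun_mx T).
Proof.
case=> a ->; rewrite /lfun_mx linearZ /= mxof1 ?(basis_free (vbasisP _)) //.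
by rewrite scalemx1; apply: mxpoly.diagonalizable_scalar.
Qed.

End Eigenvalues.

(** * Planes of L and eigenlines of T *)

Section Planes.
Set Implicit Arguments.
Unset Strict Implicit.
Variables (F : finFieldType) (L : lieAlgType F) (x : L).
Hypotheses (dimL : \dim {:L} = 3%N) (dimL' : \dim (lie_derived L) = 2%N).
Hypothesis (xV : x \notin lie_derived L).
Local Notation V := (lie_derived L).
Local Notation T := (adon V x).
Local Notation q := #|F|.
Implicit Types (u v y : L) (A B E W P : {vspace L}).

Lemma lie_linesE : lie_lines L = lines_of fullv.
Proof.
apply/setP => E; rewrite !inE subvf andbT andb_idl //.
by move/eqP/lie_subalg_line.
Qed.

Lemma lie_lines_sub U : [set A in lie_lines L | (A <= U)%VS] = lines_of U.
Proof. by apply/setP => E; rewrite lie_linesE !inE subvf andbT. Qed.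

Lemma derived_plane : V \in lie_planes L.
Proof.
rewrite inE dimL' andbT; apply/lie_prodvP => u v _ _; exact: lie_derived_mem.
Qed.

(** Two distinct planes have sum L, so the intersection has dimension 2 + 2 - 3. *)
Lemma dim_plane_meet W : W \in lie_planes L -> W != V -> \dim (W :&: V) = 1%N.
Proof.
rewrite inE => /andP[_ /eqP dW] WV; have := dimv_sum_cap W V.
suff -> : \dim (W + V) = 3%N by rewrite dW dimL' => -[].
apply/eqP; rewrite eqn_leq -{1}dimL dimvS ?subvf //= ltnNge.
apply: contra WV => dWV; rewrite eqEdim dW dimL' leqnn andbT.
have/eqP -> : V == (W + V)%VS by rewrite eqEdim addvSr dimL'.
exact: addvSl.
Qed.

(** By [eigenlineE] these are the eigenlines of T; phrased with ideals, the set does not refer to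
    x. *)
Definition ideal_lines : {set {vspace L}} :=
  [set E in lines_of V | lie_ideal E].

(** Any y in W outside E gives W = E + <y>, and [lie_subalg_add_ideal] applies. *)
Lemma plane_over_ideal_line E W :
  lie_ideal E -> \dim E = 1%N -> W \in planes_over E -> W \in lie_planes L.
Proof.
move=> idE dE; rewrite !inE => /andP[dW EW]; rewrite dW andbT.
have /subvPn[y yW yE] : ~~ (W <= E)%VS.
  by apply: contraL dW => /dimvS; rewrite dE; case: (\dim W) => [|[]].
suff -> : W = (E + <[y]>)%VS by apply: lie_subalg_add_ideal.
apply/eqP; rewrite eq_sym eqEdim subv_add EW -memvE yW.
by rewrite dim_addv_vline // dE (eqP dW).
Qed.

Lemma plane_meet_ideal W :
  W \in lie_planes L -> W != V -> (W :&: V)%VS \in ideal_lines.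
Proof.
move=> Wpl WV; rewrite !inE dim_plane_meet // capvSr /=.
move: Wpl; rewrite inE => /andP[sW /eqP dW].
apply: (lie_subalg_meet dimL dimL' xV) => //.
by apply: contra WV => sWV; rewrite eqEdim sWV dW dimL'.
Qed.

(* A plane W != V is determined by the ideal line W :&: V and one of the q
   planes other than V above it. *)
Lemma card_lie_planes : #|lie_planes L| = (1 + q * #|ideal_lines|)%N.
Proof.
rewrite (cardsD1 V) derived_plane; congr (_ + _)%N.
rewrite -sum1_card (partition_big (fun W => W :&: V)%VS (mem ideal_lines)) /=;
  last first.
  by move=> W; rewrite in_setD1 => /andP[WV Wpl]; apply: plane_meet_ideal.
rewrite mulnC -sum_nat_const; apply: eq_bigr => E;
  rewrite !inE => /andP[/andP[/eqP dE EV] idE].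
rewrite sum1_card; transitivity #|planes_over E :\ V|.
  apply: eq_card => W; rewrite [LHS]unfold_in !inE /=.
  apply/idP/idP => [/andP[/andP[WV /andP[sW dW]] /eqP<-]|/and3P[WV dW EW]].
    by rewrite WV dW capvSl.
  have Wpl : W \in lie_planes L by apply: (plane_over_ideal_line idE dE);
    rewrite inE dW.
  move: (Wpl); rewrite inE WV => -> /=.
  by rewrite eq_sym eqEdim subv_cap EW EV dim_plane_meet // dE.
have VE : V \in planes_over E by rewrite inE dimL' EV.
by have := card_planes_over dimL dE; rewrite (cardsD1 V) VE [RHS]addnC =>
  /addnI.
Qed.

Lemma ideal_linesP E :
  reflect (exists2 v : subvs_of V, v != 0 &
             (exists a, T v = a *: v) /\ E = <[vsval v]>%VS)
          (E \in ideal_lines).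
Proof.
have Tv_eq (v : subvs_of V) a : T v = a *: v <-> lie x (vsval v) = a *: vsval v.
  by rewrite -adon_derivedE -linearZ; split=> [->|/subvs_inj].
apply: (iffP idP) => [|[v v0 [[a Tv] ->]]].
  rewrite !inE => /andP[/andP[/eqP/vspace1P[e e0 ->]]]; rewrite -memvE => eV.
  case/(lie_ideal_vlineP dimL dimL' xV eV) => a xe; exists (vsproj V e).
    by apply: contraNneq e0 => e0; rewrite -(vsprojK eV) e0 linear0.
  by rewrite vsprojK //; split=> //; exists a; apply/Tv_eq; rewrite vsprojK.
rewrite !inE -memvE subvsP dim_vline andbT.
have -> /= : vsval v != 0 by apply: contraNneq v0 => v0; apply/eqP/subvs_inj;
  rewrite linear0.
by apply/(lie_ideal_vlineP dimL dimL' xV (subvsP v)); exists a; apply/Tv_eq.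
Qed.

Lemma eigenlineE E : eigenline T E <-> E \in ideal_lines.
Proof.
split=> [[v [v0 Tv ->]]|/ideal_linesP[v v0 [Tv ->]]]; last by exists v.
by apply/ideal_linesP; exists v.
Qed.

Lemma dim_subvs : \dim {:subvs_of V} = 2%N.
Proof. by rewrite dimvf. Qed.

Lemma vsval_vline_eq (v w : subvs_of V) :
  v != 0 -> v \in <[w]>%VS -> <[vsval v]>%VS = <[vsval w]>%VS.
Proof.
move=> v0 /vlineP[k vE]; apply: vline_eq.
  by apply: contraNneq v0 => v0; apply/eqP/subvs_inj; rewrite linear0.
by apply/vlineP; exists k; rewrite vE linearZ.
Qed.

Lemma ideal_lines_irreducible : irreducible_lfun T -> ideal_lines = set0.
Proof.
move=> irr; apply/eqP; rewrite -subset0; apply/subsetP =>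
  E /ideal_linesP[v v0 [[a Tv] _]].
have := irreducible_lfun_no_eigenvalue a dim_subvs irr.
by case/leigenvalueP; exists v.
Qed.

(** Eigenvectors v and w for a != b form a basis. If c v + d w is an eigenvector for k, then (a - k)
    c = 0 and (b - k) d = 0, so c or d vanishes and the eigenline is <w> or <v>. *)
Lemma card_ideal_lines2 : two_eigenvalues T -> #|ideal_lines| = 2%N.
Proof.
case=> a [b [ab /leigenvalueP[v v0 Tv] /leigenvalueP[w w0 Tw]]].
have wv : w \notin <[v]>%VS.
  apply/negP => /vlineP[k wE]; move/eqP: Tw; rewrite wE linearZ /= Tv !scalerA.
  rewrite -subr_eq0 -scalerBl scaler_eq0 (negPf v0) orbF mulrC -mulrBl
    mulf_eq0 subr_eq0 (negPf ab) /=.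
  by move=> k0; case/eqP: w0; rewrite wE (eqP k0) scale0r.
suff -> : ideal_lines = [set <[vsval v]>%VS; <[vsval w]>%VS].
  rewrite cards2; case: eqP => // eq_vw; case/negP: wv.
  have /vlineP[k wE]: vsval w \in <[vsval v]>%VS by rewrite eq_vw memv_line.
  by apply/vlineP; exists k; apply: subvs_inj; rewrite linearZ.
apply/setP => E; rewrite in_set2; apply/ideal_linesP/orP; last first.
  by case=> /eqP->; [exists v|exists w] => //; split=> //; [exists a|exists b].
case=> u u0 [[k Tu] ->]; have [c [d uE]] :=
  vspace2_coord dim_subvs v0 (memvf _) (memvf _) wv (memvf u).
have [/eqP c0 /eqP d0] : (a - k) * c = 0 /\ (b - k) * d = 0.
  apply: (lin_indep2 v0 wv); apply/eqP.
  rewrite !mulrBl !scalerBl addrACA -opprD subr_eq0 -!scalerA -scalerDr -uE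
    -Tu uE.
  by rewrite linearD !linearZ /= Tv Tw !scalerA.
move: c0 d0; rewrite !mulf_eq0 !subr_eq0.
have [c0 _ _|_] := eqVneq c 0.
  right; apply/eqP/vsval_vline_eq => //.
  by rewrite uE c0 scale0r add0r rpredZ ?memv_line.
rewrite orbF => /eqP <-; rewrite eq_sym (negPf ab) => /eqP d0.
left; apply/eqP/vsval_vline_eq => //.
by rewrite uE d0 scale0r addr0 rpredZ ?memv_line.
Qed.

(** A second eigenline would belong to the same eigenvalue, by uniqueness, and the resulting basis
    of eigenvectors would make T scalar, hence diagonalizable. *)
Lemma ideal_lines_nondiag : one_eigenvalue_nondiag T ->
  exists E, ideal_lines = [set E].
Proof.
case=> [[a [/leigenvalueP[v v0 Tv] a_uniq]] ndiag]; exists <[vsval v]>%VS.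
apply/setP => E; rewrite in_set1; apply/ideal_linesP/eqP => [|->]; last first.
  by exists v => //; split=> //; exists a.
case=> w w0 [[b Tw] ->]; have ba : a = b by apply/a_uniq/leigenvalueP; exists w.
have [/(vsval_vline_eq w0) //|wv] := boolP (w \in <[v]>%VS).
case: ndiag; apply: scalar_lfun_diagonalizable; exists a; apply/lfunP => u.
have [c [d ->]] := vspace2_coord dim_subvs v0 (memvf _) (memvf _) wv (memvf u).
rewrite scale_lfunE id_lfunE linearD !linearZ /= Tv Tw -ba scalerDr !scalerA.
by rewrite (mulrC a c) (mulrC a d).
Qed.

Lemma lie_scalar a v : T = a *: \1%VF -> v \in V -> lie x v = a *: v.
Proof.
by move=> Ta vV; rewrite -{1}(vsprojK vV) -adon_derivedE Ta scale_lfunE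
  id_lfunE linearZ /= vsprojK.
Qed.

Lemma ideal_lines_scalar : scalar_lfun T -> ideal_lines = lines_of V.
Proof.
case=> a Ta; apply/setP => E; rewrite inE andb_idr // inE =>
  /andP[/eqP/vspace1P[e e0 ->]].
rewrite -memvE => eV; apply/(lie_ideal_vlineP dimL dimL' xV eV); exists a.
exact: lie_scalar.
Qed.

(** For y = v + k x and z = w + l x, the bracket is a (k w - l v) = a (k z - l y), as the terms in x
    cancel. It is thus a combination of y and z themselves, so every subspace is closed. *)
Lemma lie_subalg_scalar W : scalar_lfun T -> lie_subalg W.
Proof.
case=> a Ta; apply/lie_prodvP => y z yW zW.
have [v vV [k yE]] := decomp_derived dimL dimL' xV y.
have [w wV [l zE]] := decomp_derived dimL dimL' xV z.
suff -> : lie y z = a *: (k *: z - l *: y) by rewrite rpredZ ?rpredB ?rpredZ.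
rewrite yE zE lieDl !linearD /= !lieZl !linearZ /= [lie v x]lieC lie_alt.
rewrite (lie_derived_abelian dimL dimL' xV) // !(lie_scalar Ta) // !scaler0
  addr0 add0r.
by rewrite !scalerN !scalerA [k * l]mulrC addrACA subrr addr0 addrC.
Qed.

End Planes.

(** * Adjacency rules in dimension 3 *)

Section ComaximalGraph.
Set Implicit Arguments.
Unset Strict Implicit.
Variables (F : finFieldType) (L : lieAlgType F).
Hypothesis dimL : \dim {:L} = 3%N.
Local Notation G := (comax_graph L).
Implicit Types A B P : {vspace L}.

Lemma line_vertex A : A \in lie_lines L -> A \in comax_vertices L.
Proof.
rewrite !inE => /andP[-> dA] /=; rewrite -dimv_eq0 (eqP dA) /=.
by apply: contraTneq dA => ->; rewrite dimL.
Qed.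

Lemma plane_vertex P : P \in lie_planes L -> P \in comax_vertices L.
Proof.
rewrite !inE => /andP[-> dP] /=; rewrite -dimv_eq0 (eqP dP) /=.
by apply: contraTneq dP => ->; rewrite dimL.
Qed.

Lemma comax_vertexE A :
  A \in comax_vertices L -> (A \in lie_lines L) || (A \in lie_planes L).
Proof.
rewrite !inE => /and3P[-> A0 Af] /=.
have : (\dim A < 3)%N.
  rewrite -dimL ltn_neqAle dimvS ?subvf // andbT.
  by apply: contra Af => /eqP dA; rewrite eqEdim subvf dA leqnn.
by move: A0; rewrite -dimv_eq0; case: (\dim A) => [|[|[]]].
Qed.

Lemma lie_gen_add A B : (A + B <= lie_gen A B)%VS.
Proof. by have [_ sA sB] := lie_gen_subalg A B; rewrite subv_add sA. Qed.

Lemma comax_adj A B : A \in comax_vertices L -> B \in comax_vertices L ->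
  A != B -> \dim (A + B) = 3%N -> adj G A B.
Proof.
move=> vA vB AB dAB; apply/and4P; split=> //.
by rewrite eqEdim subvf dimL -dAB dimvS ?lie_gen_add.
Qed.

(** The proper subalgebra P contains the one generated by A and B. Together with [comax_adj], where
    A + B is already L, this decides all adjacencies below. *)
Lemma comax_nadj A B P : P \in comax_vertices L -> (A <= P)%VS -> (B <= P)%VS ->
  ~~ adj G A B.
Proof.
rewrite inE => /and3P[sP _ Pf] AP BP; apply/negP => /and4P[_ _ _ /eqP fAB].
by case/negP: Pf; rewrite eqEdim subvf dimvS // -fAB lie_genS.
Qed.

Lemma dim_add_planes A B : A \in lie_planes L -> B \in lie_planes L -> A != B ->
  \dim (A + B) = 3%N.
Proof.
rewrite !inE => /andP[_ /eqP dA] /andP[_ /eqP dB] AB; apply/eqP.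
rewrite eqn_leq -{1}dimL dimvS ?subvf //= ltnNge; apply: contra AB => dAB.
have /eqP-> : A == (A + B)%VS by rewrite eqEdim addvSl dA.
by rewrite eq_sym eqEdim addvSr dB.
Qed.

Lemma adj_planes A B : A \in lie_planes L -> B \in lie_planes L -> A != B ->
  adj G A B.
Proof. by move=> pA pB AB; rewrite comax_adj ?plane_vertex ?dim_add_planes. Qed.

Lemma adj_line_plane A P : A \in lie_lines L -> P \in lie_planes L ->
  adj G A P = ~~ (A <= P)%VS.
Proof.
move=> lA pP; apply/idP/idP => [|AP].
  by apply: contraTN => AP; apply: comax_nadj (plane_vertex pP) AP (subvv P).
apply: comax_adj (line_vertex lA) (plane_vertex pP) _ _.
  by apply: contraNneq AP => ->; rewrite subvv.
move: lA pP; rewrite addvC !inE => /andP[_ /eqP dA] /andP[_ /eqP dP].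
exact: dim_plane_add_line.
Qed.

(** If A and B are not adjacent, the subalgebra they generate is the required plane: it is proper,
    so of dimension at most 2, and it contains the two-dimensional A + B. *)
Lemma nadj_lines A B : A \in lie_lines L -> B \in lie_lines L -> A != B ->
  ~~ adj G A B <-> exists2 P, P \in lie_planes L & (A <= P)%VS && (B <= P)%VS.
Proof.
move=> lA lB AB; split=> [|[P pP /andP[AP BP]]]; last first.
  exact: comax_nadj (plane_vertex pP) AP BP.
have [sG AG BG] := lie_gen_subalg A B; move=> nAB.
exists (lie_gen A B); last by rewrite AG.
rewrite inE sG /= eqn_leq; apply/andP; split.
  rewrite -ltnS -dimL ltn_neqAle dimvS ?subvf // andbT.
  apply: contra nAB => dG; apply/and4P; split; rewrite ?line_vertex //.
  by rewrite eqEdim subvf (eqP dG) /=.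
move: lA lB; rewrite !inE => /andP[_ /eqP dA] /andP[_ /eqP dB].
by rewrite -(dim_add_lines dA dB AB) dimvS ?lie_gen_add.
Qed.

End ComaximalGraph.

(** * Assembly of the counts and of the four cases *)

Theorem proposition4p7 (F : finFieldType) (L : lieAlgType F) (x : L)
    (dimL : \dim {:L} = 3%N) (dimL' : \dim (lie_derived L) = 2%N)
    (xV : x \notin lie_derived L) :
  let q := #|F| in
  let V := lie_derived L in
  let T := adon V x in
  let G := comax_graph L in
  let lines := lie_lines L in
  let planes := lie_planes L in
  (* V is an abelian ideal and T is invertible *)
  ([/\ lie_ideal V, lie_abelian V & bijective T]) /\
  (* (1) *)
  (#|lines| = q ^ 2 + q + 1)%N /\
  (* (2) *)
  ([/\ irreducible_lfun T -> #|planes| = 1%N,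
       two_eigenvalues T -> #|planes| = (1 + 2 * q)%N,
       one_eigenvalue_nondiag T -> #|planes| = (1 + q)%N
     & scalar_lfun T -> #|planes| = (1 + q + q ^ 2)%N]) /\
  (* (3) *)
  ([/\ ((forall A B, A \in planes -> B \in planes -> A != B -> adj G A B)
        /\ sgraph_eq (induced G planes) (complete planes)),
       (forall A P, A \in lines -> P \in planes ->
          (adj G A P <-> ~~ (A <= P)%VS))
     & (forall A B, A \in lines -> B \in lines -> A != B ->
          (~~ adj G A B <->
           exists2 P, P \in planes & (A <= P)%VS && (B <= P)%VS))]) /\
  (* (i) *)
  (irreducible_lfun T ->
     let lines_in := [set A in lines | (A <= V)%VS] in
     let lines_out := [set A in lines | ~~ (A <= V)%VS] in
     [/\ is_join (induced G lines) (edgeless lines_in) (complete lines_out),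
         #|lines_in| = (q + 1)%N & #|lines_out| = (q ^ 2)%N]) /\
  (* (ii) *)
  (one_eigenvalue_nondiag T ->
     exists E : {vspace L},
       [/\ unique (eigenline T) E, isolated G E
         & forall P, P \in planes -> (E <= P)%VS]) /\
  (* (iii) *)
  (scalar_lfun T ->
     (forall A B, A \in lines -> B \in lines -> ~~ adj G A B) /\
     (forall A B, A \in lines -> B \in lines -> A != B ->
        (A + B)%VS \in planes)).
Proof.
move=> q V T G lines planes.
have lE : lines = lines_of fullv := lie_linesE L.
have cardV : #|lines_of V| = (q + 1)%N.
  by rewrite card_lines dimL' big_ord_recr big_ord1 /= expn1 addnC.
have cardL : #|lines| = (q ^ 2 + q + 1)%N.
  rewrite lE card_lines dimL !big_ord_recr big_ord0 /= expn1 add0n.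
  by rewrite [RHS]addnC [(q ^ 2 + q)%N]addnC addnA.
have planesE := card_lie_planes dimL dimL' xV.
have planes1 : irreducible_lfun T -> #|planes| = 1%N.
  by move=> irr; rewrite planesE (ideal_lines_irreducible dimL dimL' xV irr)
    cards0 muln0.
have VP : V \in planes := derived_plane dimL'.
split.
  split; [exact: lie_derived_ideal| |exact: adon_derived_bij].
  rewrite /lie_abelian -subv0; apply/lie_prodvP => u v uV vV.
  by rewrite (lie_derived_abelian dimL dimL' xV) ?mem0v.
split=> //; split.
  split=> //.
  - by move=> two; rewrite planesE (card_ideal_lines2 dimL dimL' xV two) mulnC.
  - by case/(ideal_lines_nondiag dimL dimL' xV) => E IE;
    rewrite planesE IE cards1 muln1.
  - move=> sc; rewrite planesE (ideal_lines_scalar dimL dimL' xV sc) cardV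
    mulnDr muln1.
    by rewrite -addnA [(q + _)%N]addnC mulnn.
split.
  split; first split=> [A B pA pB AB|].
  - exact: adj_planes.
  - split=> [|A B] /=.
      by apply/setP => A; rewrite in_setI andb_idl // => /(plane_vertex dimL).
    case pA: (A \in _) => //; case pB: (B \in _) => //=.
    apply/idP/idP => [/and4P[] //|]; exact: adj_planes.
  - by move=> A P lA pP; rewrite adj_line_plane.
  - by move=> A B lA lB AB; apply: nadj_lines.
split.
  move=> irr lines_in lines_out.
  have lines_inE : lines_in = lines_of V := lie_lines_sub V.
  have cin : #|lines_in| = (q + 1)%N by rewrite lines_inE.
  have in_in C : (C \in lines_in) = (C \in lines) && (C <= V)%VS
    by rewrite in_set.
  have in_out C : (C \in lines_out) = (C \in lines) && ~~ (C <= V)%VS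
    by rewrite in_set.
  have linesD A : (A \in lines) = (A \in lines_in) || (A \in lines_out).
    by rewrite in_in in_out -andb_orr orbN andbT.
  split=> //.
    split=> [||A B].
    - rewrite -setI_eq0; apply/eqP/setP => A;
      rewrite in_setI in_in in_out in_set0.
      by case: (A <= V)%VS; rewrite ?andbF.
    - apply/setP => A; rewrite in_setI in_setU linesD andb_idl // -linesD.
      exact: line_vertex.
    have -> : adj (induced G lines) A B =
      [&& A \in lines, B \in lines & adj G A B] by [].
    have -> : adj (complete lines_out) A B =
      [&& A \in lines_out, B \in lines_out & A != B] by [].
    have [-> ->] : vset (edgeless lines_in) = lines_in /\
      vset (complete lines_out) = lines_out by [].
    have -> : adj (edgeless lines_in) A B = false by [].
    (* In Case 1 the only plane is V, so rule (c) says that distinct lines fail to be adjacent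
       exactly when both lie in V. *)
    have adjL : A \in lines -> B \in lines ->
        adj G A B = (A != B) && ~~ ((A <= V)%VS && (B <= V)%VS).
      move=> lA lB; have [->|AB] := eqVneq A B; first by rewrite adj_irr.
      apply: negb_inj; rewrite negbK; apply/idP/idP => [|/andP[AV BV]].
        case/(nadj_lines dimL lA lB AB) => P.
        have /eqP/cards1P[W WE] := planes1 irr.
        move: VP; rewrite -/planes WE !in_set1 => /eqP-> /eqP-> //.
      exact: comax_nadj (plane_vertex dimL VP) AV BV.
    rewrite !in_in !in_out.
    have [lA|_] := boolP (A \in lines) => //;
      have [lB|_] := boolP (B \in lines); last by rewrite !andbF.
    rewrite [adj _ A B]adjL // !andTb; have [<-|_] := eqVneq A B.
      by case: (A <= V)%VS.
    by case: (A <= V)%VS; case: (B <= V)%VS.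
  (* The lines outside V are counted by difference: q^2 + q + 1 lines in all, of which q + 1 lie in
     V. *)
  have := cardsID lines_in lines; rewrite cardL.
  have -> : lines :&: lines_in = lines_in.
    by apply/setIidPr/subsetP => A; rewrite in_in => /andP[].
  have -> : lines :\: lines_in = lines_out.
    by apply/setP => A; rewrite in_setD in_in in_out; case: (A \in lines);
      rewrite ?andbF ?andbT.
  by rewrite cin -[RHS]addnA [RHS]addnC => /addnI.
split.
  case/(ideal_lines_nondiag dimL dimL' xV) => E IE.
  have EI : E \in ideal_lines L by rewrite IE set11.
  have [dE EV idE] : [/\ \dim E = 1%N, (E <= V)%VS & lie_ideal E].
    by move: EI; rewrite !inE => /andP[/andP[/eqP]].
  (* A plane other than V meets V in an ideal line, and E is the only one. *)
  have E_sub P : P \in planes -> (E <= P)%VS.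
    move=> pP; have [->//|PV] := eqVneq P V.
    suff : (P :&: V)%VS \in ideal_lines L.
      by rewrite IE in_set1 => /eqP <-; apply: capvSl.
    exact: (plane_meet_ideal dimL dimL' xV pP PV).
  have lEE : E \in lines by rewrite lE inE dE subvf.
  exists E; split=> //.
    split=> [|E' /(eigenlineE dimL dimL' xV)];
      last by rewrite IE in_set1 => /eqP.
    exact/(eigenlineE dimL dimL' xV).
  split=> [|B]; first exact: line_vertex.
  apply/negP => EB; have := EB; rewrite adj_sym =>
    /adj_vset/(comax_vertexE dimL)/orP[lB|pB].
    have neqEB : E != B by apply: contraTneq EB => ->; rewrite adj_irr.
    have dB : \dim B = 1%N by move: lB; rewrite inE => /andP[_ /eqP].
    (* As E is an ideal, its sum with any other line is a plane subalgebra, so no line is adjacent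
       to E. *)
    have pEB : (E + B)%VS \in planes.
      by apply: (plane_over_ideal_line idE dE);
        rewrite inE addvSl dim_add_lines.
    by have := comax_nadj (plane_vertex dimL pEB) (addvSl E B) (addvSr E B);
      rewrite EB.
  by move: EB; rewrite adj_line_plane // E_sub.
move=> sc.
have add_plane A B : A \in lines -> B \in lines -> A != B ->
  (A + B)%VS \in planes.
  rewrite lE !inE !subvf !andbT => /eqP dA /eqP dB AB.
  by rewrite dim_add_lines // andbT; apply: lie_subalg_scalar sc.
(* The first claim of (iii) does not assume A and B distinct; equal lines are covered by
   irreflexivity. *)
split=> // A B lA lB; have [->|AB] := eqVneq A B; first by rewrite adj_irr.
exact: comax_nadj (plane_vertex dimL (add_plane A B lA lB AB)) (addvSl A B)
  (addvSr A B).
Qed.
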